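(* Let $\mathcal{X}\subseteq\mathbb{R}^d$, let $\pi:\mathcal{X}\to\mathbb{R}^+$ be a density, $\sigma>0$, $\lambda>0$, $M\ge1$, and let $\Psi_{\mathrm{MSIP},\lambda}(\cdot\,;\pi)$ be the regularized mean shift interacting particles (MSIP) map for $\pi$. Then for any $Y\in\mathcal{X}^M$ at which the map is defined (i.e. all entries of $\bm{w}^*_\lambda(Y;\pi)$ are nonzero) and every $C>0$, the map $\Psi_{\mathrm{MSIP},\lambda}(\cdot\,;C\pi)$ is also defined at $Y$ and $$\Psi_{\mathrm{MSIP},\lambda}(Y;\pi)=\Psi_{\mathrm{MSIP},\lambda}(Y;C\pi).$$
   Context: A configuration $Y\in\mathcal{X}^M$ of points $y_1,\dots,y_M\in\mathcal{X}$ is identified with the $M\times d$ matrix whose $i$-th row is $y_i$. The kernel is the squared exponential kernel $\kappa(x,y)=\exp\bigl(-\tfrac{1}{2\sigma^2}\|x-y\|^2\bigr)$; $[\bm{K}(Y)]_{ij}=\kappa(y_i,y_j)$ and $\bm{K}_\lambda(Y)=\bm{K}(Y)+\lambda\bm{I}_M$. A density $\pi$ is a nonnegative Lebesgue-integrable function on $\mathcal{X}$ (not identically zero; it need not be normalized), and $\mathrm{d}\pi(x)=\pi(x)\,\mathrm{d}x$. Define $v_0(y;\pi)=\int_{\mathcal{X}}\kappa(x,y)\,\mathrm{d}\pi(x)$ and $v_1(y;\pi)=\int_{\mathcal{X}}x\,\kappa(x,y)\,\mathrm{d}\pi(x)\in\mathbb{R}^d$; $\bm{v}_0(Y;\pi)\in\mathbb{R}^M$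 has $i$-th entry $v_0(y_i;\pi)$ and $\bm{v}_1(Y;\pi)\in\mathbb{R}^{M\times d}$ has $i$-th row $v_1(y_i;\pi)$. Set $\bm{w}^*_\lambda(Y;\pi)=\bm{K}_\lambda(Y)^{-1}\bm{v}_0(Y;\pi)$ and $\bm{W}^*_\lambda(Y;\pi)=\mathrm{diag}(\bm{w}^*_\lambda(Y;\pi))$. The regularized MSIP map is $$\Psi_{\mathrm{MSIP},\lambda}(Y;\pi)=\bm{W}^*_\lambda(Y;\pi)^{-1}\,\bm{K}_\lambda(Y)^{-1}\,\bm{v}_1(Y;\pi)\in\mathbb{R}^{M\times d},$$ defined whenever all entries of $\bm{w}^*_\lambda(Y;\pi)$ are nonzero. *)

(* Defs.v *)
From HB Require Import structures.
From mathcomp Require Import all_boot all_order all_algebra.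
From mathcomp Require Import all_classical all_reals all_analysis.

Set Implicit Arguments.
Unset Strict Implicit.
Unset Printing Implicit Defensive.

Import Order.TTheory GRing.Theory Num.Theory.
Import numFieldNormedType.Exports.

Local Open Scope classical_set_scope.
Local Open Scope ring_scope.

Section lebesgue_outer_measure.
Context {R : realType}.

Definition box d (a b : 'rV[R]_d) : set 'rV[R]_d :=
  [set x | forall j, a 0 j <= x 0 j <= b 0 j].

Definition box_volume d (a b : 'rV[R]_d) : R := \prod_(j < d) (b 0 j - a 0 j).

(* The family is indexed by an arbitrary I : set nat, so finite and empty
   families are allowed; only for d = 0, where every box has volume 1, does
   this differ from requiring infinite sequences of boxes. *)
Definition box_cover d (A : set 'rV[R]_d)
    (c : set nat * (nat -> 'rV[R]_d * 'rV[R]_d)) : Prop :=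
  (forall k j, (c.2 k).1 0 j <= (c.2 k).2 0 j) /\
  A `<=` \bigcup_(k in c.1) box (c.2 k).1 (c.2 k).2.

Definition cover_volume d (c : set nat * (nat -> 'rV[R]_d * 'rV[R]_d)) : \bar R :=
  (\esum_(k in c.1) (box_volume (c.2 k).1 (c.2 k).2)%:E)%E.

Definition lebesgue_outer d (A : set 'rV[R]_d) : \bar R :=
  ereal_inf [set cover_volume c | c in box_cover A].

Local Open Scope ereal_scope.

Lemma box_cover_ge0 d A c k : @box_cover d A c ->
  0 <= (box_volume (c.2 k).1 (c.2 k).2)%:E.
Proof.
by move=> [cP _]; rewrite lee_fin; apply: prodr_ge0 => j _; rewrite subr_ge0.
Qed.

Lemma cover_volume_ge0 d A c : @box_cover d A c -> 0 <= cover_volume c.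
Proof. by move=> cP; apply: esum_ge0 => k _; exact: (box_cover_ge0 k cP). Qed.

Lemma lebesgue_outer_ge0 d A : 0 <= @lebesgue_outer d A.
Proof.
by apply: le_ereal_inf_tmp => _ [c cA <-]; exact: cover_volume_ge0 cA.
Qed.

Lemma lebesgue_outer0 d : @lebesgue_outer d set0 = 0.
Proof.
apply/eqP; rewrite eq_le lebesgue_outer_ge0 andbT.
apply: ereal_inf_lbound; exists (set0, fun=> (0%R, 0%R)).
  by split => [k j|x []]; rewrite /= ?mxE.
by rewrite /cover_volume esum_set0.
Qed.

Lemma le_lebesgue_outer d :
  {homo @lebesgue_outer d : A B / A `<=` B >-> A <= B}.
Proof.
move=> A B AB; apply: ereal_inf_le_tmp => _ [c [cP cB] <-].
by exists c => //; split => //; exact: subset_trans cB.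
Qed.

Lemma lebesgue_outer_sigma_subadditive d : sigma_subadditive (@lebesgue_outer d).
Proof.
move=> A; have [[i ioo]|] := pselect (exists i, lebesgue_outer (A i) = +oo).
  rewrite (eseries_pinfty _ _ ioo) ?leey// => n _.
  by rewrite -ltNye (lt_le_trans _ (lebesgue_outer_ge0 _)).
rewrite -forallNE => Aoo; apply/lee_addgt0Pr => _/posnumP[e].
rewrite (le_trans _ (epsilon_trick _ _ _))//; last first.
  by move=> n; exact: lebesgue_outer_ge0.
pose P n c := box_cover (A n) c /\
  cover_volume c <= lebesgue_outer (A n) + (e%:num / (2 ^ n.+1)%:R)%:E.
have [G PG] : {G & forall n, P n (G n)}.
  apply: (@choice _ _ P) => n.
  have /lb_ereal_inf_adherent : lebesgue_outer (A n) \is a fin_num.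
    by rewrite ge0_fin_numE ?lebesgue_outer_ge0// ltey; apply/eqP/Aoo.
  have en : (0 < e%:num / (2 ^ n.+1)%:R)%R by [].
  move=> /(_ _ en) [_ [c cA <-] cle].
  by exists c; split => //; exact: ltW.
have /card_esym/ppcard_eqP[f] := card_nat2.
pose K : set (nat * nat) := setT `*`` (fun n => (G n).1).
pose I : set nat := [set m | K (f m)].
apply: (@le_trans _ _ (\esum_(k in K)
    (box_volume ((G k.1).2 k.2).1 ((G k.1).2 k.2).2)%:E)).
  apply: ereal_inf_lbound; exists (I, fun m => (G (f m).1).2 (f m).2).
    split => [k j /=|x [n _]]; first exact: (PG _).1.1.
    move=> /((PG n).1.2) [k Gk xk].
    by exists (f^-1%FUN (n, k)); rewrite /I /K /= invK ?inE.
  rewrite /cover_volume /= [RHS](reindex_esum I K f)//; split => //.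
  - by move=> m n _ _ /(@inj _ _ setT f); apply; rewrite inE.
  - by move=> k Kk; exists (f^-1%FUN k); rewrite /I /= ?invK ?inE.
rewrite -(esum_esum (a := fun n k =>
  (box_volume ((G n).2 k).1 ((G n).2 k).2)%:E)); last first.
  by move=> n k _ _; exact: (box_cover_ge0 k (PG n).1).
rewrite -nneseries_esumT; last first.
  by move=> n; exact: (cover_volume_ge0 (PG n).1).
apply: lee_nneseries => n _; last exact: (PG n).2.
by move=> _; exact: (cover_volume_ge0 (PG n).1).
Qed.

HB.instance Definition _ d := isOuterMeasure.Build R 'rV[R]_d (@lebesgue_outer d)
  (lebesgue_outer0 d) (@lebesgue_outer_ge0 d) (@le_lebesgue_outer d)
  (@lebesgue_outer_sigma_subadditive d).

End lebesgue_outer_measure.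

(* R^d with the sigma-algebra of Lebesgue (Caratheodory) measurable sets. *)
Definition euclidean (R : realType) (d : nat) :=
  caratheodory_type (@lebesgue_outer R d).
HB.instance Definition _ R d := Measurable.on (euclidean R d).

Definition lebesgue (R : realType) (d : nat) : set (euclidean R d) -> \bar R :=
  @lebesgue_outer R d.

HB.instance Definition _ R d := isMeasure.Build _ (euclidean R d) R
  (@lebesgue R d)
  (@caratheodory_measure0 R 'rV[R]_d (@lebesgue_outer R d))
  (@caratheodory_measure_ge0 R 'rV[R]_d (@lebesgue_outer R d))
  (@caratheodory_measure_sigma_additive R 'rV[R]_d (@lebesgue_outer R d)).

Section msip.
Context {R : realType} {d : nat}.
Implicit Types (X : set 'rV[R]_d) (p : 'rV[R]_d -> R).

(* The library norm `|x| on 'rV[R]_d is the sup norm. *)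
Definition euclidean_norm (x : 'rV[R]_d) : R :=
  Num.sqrt (\sum_(j < d) x 0 j ^+ 2).

Definition se_kernel (sigma : R) (x y : 'rV[R]_d) : R :=
  expR (- (1 / (2 * sigma ^+ 2)) * euclidean_norm (x - y) ^+ 2).

(* Densities on X are total functions whose values outside X are irrelevant.
   Integrability is asked of the extension by zero: it is integrability on X
   when X is measurable (integrable_mkcond), whereas the library's
   measurable_fun X is vacuous when X is not measurable. *)
Definition density X p : Prop :=
  [/\ forall x, X x -> 0 <= p x,
      (@lebesgue R d).-integrable setT ((EFin \o p) \_ X) &
      exists2 x, X x & p x != 0].

Definition v0 (sigma : R) X p (y : 'rV[R]_d) : R :=
  \int[@lebesgue R d]_(x in X) (se_kernel sigma x y * p x).

Definition v1 (sigma : R) X p (y : 'rV[R]_d) : 'rV[R]_d :=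
  \row_j \int[@lebesgue R d]_(x in X) ((x : 'rV[R]_d) 0 j * se_kernel sigma x y * p x).

Context {M : nat}.
Implicit Types Y : 'M[R]_(M, d).

Definition gram (sigma : R) Y : 'M[R]_M :=
  \matrix_(i, j) se_kernel sigma (row i Y) (row j Y).

Definition reg_gram (sigma lambda : R) Y : 'M[R]_M :=
  gram sigma Y + lambda%:M.

Definition v0_config (sigma : R) X p Y : 'cV[R]_M :=
  \col_i v0 sigma X p (row i Y).

Definition v1_config (sigma : R) X p Y : 'M[R]_(M, d) :=
  \matrix_(i < M) v1 sigma X p (row i Y).

(* gram is positive semidefinite, so for 0 < lambda the matrix reg_gram is a
   unit and invmx is its genuine inverse. *)
Definition opt_weights (sigma lambda : R) X p Y : 'cV[R]_M :=
  invmx (reg_gram sigma lambda Y) *m v0_config sigma X p Y.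

Definition opt_weights_mx (sigma lambda : R) X p Y : 'M[R]_M :=
  diag_mx (opt_weights sigma lambda X p Y)^T.

Definition msip_defined (sigma lambda : R) X p Y : Prop :=
  forall i, opt_weights sigma lambda X p Y i 0 != 0.

(* Meaningful only under msip_defined: invmx A is A when A is singular. *)
Definition msip (sigma lambda : R) X p Y : 'M[R]_(M, d) :=
  invmx (opt_weights_mx sigma lambda X p Y)
    *m invmx (reg_gram sigma lambda Y) *m v1_config sigma X p Y.

End msip.

(* Main.v *)
(** The weights are linear in [p]: scaling [p] by [C] scales [v0], [v1] and
    hence the diagonal weight matrix by [C], and [C^-1 * C] cancels in the map.
    No measurability has to be checked: for [0 < C] the integral of an
    arbitrary function scales by [C], because [h |-> C h] is a bijection between
    the simple functions lying below [f] and those lying below [C f]. *)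
Require Import Defs.
From mathcomp Require Import all_boot all_order all_algebra.
From mathcomp Require Import all_classical all_reals all_analysis.

Import Order.TTheory GRing.Theory Num.Theory.
Import numFieldNormedType.Exports.

Local Open Scope classical_set_scope.
Local Open Scope ring_scope.

Section integral_pZl.
Import HBNNSimple.
Local Open Scope ereal_scope.
Context d (T : measurableType d) (R : realType).
Variable mu : {measure set T -> \bar R}.
Implicit Types (f : T -> \bar R) (D : set T) (c : R).

(** For nonnegative [f] the supremum of such a set is by definition the integral of [f], so taking
    suprema turns this equality of sets into scaling of the integral. *)
Lemma image_sintegral_pZl f c : (0 < c)%R ->
  [set sintegral mu h | h in [set h : {nnsfun T >-> R} |
    forall x, (h x)%:E <= c%:E * f x]] =
  [set c%:E * y | y in [set sintegral mu h | h in [set h : {nnsfun T >-> R} |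
    forall x, (h x)%:E <= f x]]].
Proof.
move=> c0; have ci0 : (0 < c^-1)%R by rewrite invr_gt0.
apply/seteqP; split => [_ [h hf <-]|_ [_ [h hf <-] <-]] /=.
- pose g := scale_nnsfun h (ltW ci0).
  exists (sintegral mu g).
    by exists g => // x; rewrite /= EFinM lee_pdivrMl.
  rewrite -sintegralrM; apply: eq_sintegral => x /=.
  by rewrite mulrA divff ?mul1r// gt_eqF.
- exists (scale_nnsfun h (ltW c0)); last by rewrite -sintegralrM.
  by move=> x; rewrite /= EFinM lee_pmul2l.
Qed.

(** Needed because the positive and negative parts of an arbitrary function may both have infinite
    integral. A positive finite factor fixes [+oo] and [-oo], so even the conventional value of
    [+oo - +oo] is respected. *)
Lemma muleBr_gt0 c (x y : \bar R) : (0 < c)%R ->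
  c%:E * (x - y) = c%:E * x - c%:E * y.
Proof.
move=> c0; have cE : 0 < c%:E by rewrite lte_fin.
by case: x y => [x| |] [y| |];
  rewrite ?(gt0_muley cE) ?(gt0_muleNy cE) //= -?EFinM -?EFinB -?EFinM ?mulrBr.
Qed.

Lemma integral_pZl D f c : (0 < c)%R ->
  \int[mu]_(x in D) (c%:E * f x) = c%:E * \int[mu]_(x in D) f x.
Proof.
move=> c0; rewrite /integral erestrict_scale.
rewrite ge0_funeposM ?ge0_funenegM ?(ltW c0)//.
by rewrite !image_sintegral_pZl// !ereal_sup_pZl// muleBr_gt0.
Qed.

Lemma Rintegral_pZl D (f : T -> R) c : (0 < c)%R ->
  (\int[mu]_(x in D) (c * f x) = c * \int[mu]_(x in D) f x)%R.
Proof.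
move=> c0; rewrite /Rintegral; under eq_integral do rewrite EFinM.
rewrite integral_pZl//; have cE : 0 < c%:E by rewrite lte_fin.
(* [fine] sends both infinities to 0, so in the two infinite cases the claim reads [0 = c * 0]. *)
case: integral => [r| |] //.
- by rewrite (gt0_muley cE) mulr0.
- by rewrite (gt0_muleNy cE) mulr0.
Qed.

End integral_pZl.

Section msip_scale.
Context {R : realType} {d M : nat}.
Variables (X : set 'rV[R]_d) (p : 'rV[R]_d -> R) (sigma lambda C : R).
Variable Y : 'M[R]_(M, d).
Hypothesis C0 : 0 < C.

Lemma v0_configZ :
  v0_config sigma X (fun x => C * p x) Y = C *: v0_config sigma X p Y.
Proof.
apply/colP => i; rewrite !mxE /v0 -Rintegral_pZl//.
by apply: eq_Rintegral => x _; rewrite mulrCA.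
Qed.

Lemma v1_configZ :
  v1_config sigma X (fun x => C * p x) Y = C *: v1_config sigma X p Y.
Proof.
apply/matrixP => i j; rewrite !mxE -Rintegral_pZl//.
by apply: eq_Rintegral => x _; rewrite mulrCA.
Qed.

Lemma opt_weightsZ :
  opt_weights sigma lambda X (fun x => C * p x) Y =
  C *: opt_weights sigma lambda X p Y.
Proof. by rewrite /opt_weights v0_configZ scalemxAr. Qed.

Lemma opt_weights_mxZ :
  opt_weights_mx sigma lambda X (fun x => C * p x) Y =
  C *: opt_weights_mx sigma lambda X p Y.
Proof. by rewrite /opt_weights_mx opt_weightsZ !linearZ. Qed.

(** The determinant is the product of the weights. Invertibility is what allows [C^-1] to be pulled
    out of [invmx], which would leave a singular matrix unchanged. *)
Lemma unitmx_opt_weights_mx : msip_defined sigma lambda X p Y ->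
  opt_weights_mx sigma lambda X p Y \in unitmx.
Proof.
move=> wN0; rewrite unitmxE det_diag unitfE; apply/prodf_neq0 => i _.
by rewrite mxE.
Qed.

End msip_scale.

Theorem proposition3p2 (R : realType) (d M : nat) (X : set 'rV[R]_d)
    (p : 'rV[R]_d -> R) (sigma lambda : R) :
  density X p -> 0 < sigma -> 0 < lambda -> (1 <= M)%N ->
  forall (Y : 'M[R]_(M, d)) (C : R),
    (forall i, X (row i Y)) ->
    msip_defined sigma lambda X p Y ->
    0 < C ->
    msip_defined sigma lambda X (fun x => C * p x) Y /\
    msip sigma lambda X p Y = msip sigma lambda X (fun x => C * p x) Y.
Proof.
move=> _ _ _ _ Y C _ wN0 C0; have CN0 : C != 0 by rewrite gt_eqF.
split=> [i|]; first by rewrite opt_weightsZ// mxE mulf_neq0.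
rewrite /msip opt_weights_mxZ// v1_configZ// invmxZ; last first.
  by rewrite unitmxZ ?unitfE// unitmx_opt_weights_mx.
by rewrite -!scalemxAl -scalemxAr scalerA mulVf// scale1r.
Qed.
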